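(* Let $u=\log x$. (a) For any $p>0$ there is a constant $A(p)$ such that $$F^{(p)}(x)=e\,u-A(p)+O(u^{-1})\qquad\text{as }x\to\infty .$$ The function $A(\cdot)$ is increasing. (b) If $p>1$, then $F^{(p)}(x)=F\!\left(\frac{x}{p}\right)$, where $F=F^{(1)}$; so $A(p)=A+e\log p$, where $A=A(1)$. (c) If $0<p<1$, then the function $A(p)$ satisfies the functional equation $$A(p)=\max_{1\le v\le e}\left(A\!\left(\frac pv\right)-v+e\log v\right)+p .$$ The asymptotics of $A(p)$ as $p\to+0$ is $$A(p)=\frac{p}{1-e^{-1}}+o(p).$$
   Context: For $p>0$, $n\in\mathbb N=\{1,2,\dots\}$ and $x>0$ define $$S^{(p)}_n(t_1,\dots,t_n)=t_1+\sum_{j=2}^n\frac{t_j}{t_{j-1}+p},\qquad F^{(p)}_n(x)=\inf_{t_1,\dots,t_{n-1}\ge0,\ t_n=x}S_n^{(p)}(t_1,\dots,t_n),$$ (so $F_1^{(p)}(x)=x$), and $F^{(p)}(x)=\inf_{n\in\mathbb N}F_n^{(p)}(x)$. Write $F=F^{(1)}$. *)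

(* Defs.v *)
From HB Require Import structures.
From mathcomp Require Import all_boot all_order all_algebra.
From mathcomp Require Import all_classical all_reals all_analysis.
Set Implicit Arguments.
Unset Strict Implicit.
Unset Printing Implicit Defensive.
Import Order.TTheory GRing.Theory Num.Theory.
Import numFieldNormedType.Exports.
Local Open Scope classical_set_scope.
Local Open Scope ring_scope.

(* The finite sequence t_1, ..., t_n is the restriction to the indices 1, ..., n
   of a sequence t : nat -> R; all other values of t are irrelevant. *)
Definition sumS (R : realType) (p : R) (n : nat) (t : nat -> R) : R :=
  t 1%N + \sum_(2 <= j < n.+1) t j / (t j.-1 + p).

(* For p > 0, x > 0 and n >= 1 the sets below are nonempty and bounded below
   by 0, so that [inf] is the genuine infimum. *)
Definition infFn (R : realType) (p : R) (n : nat) (x : R) : R :=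
  inf [set sumS p n t | t in
    [set t : nat -> R | (forall j, (1 <= j < n)%N -> 0 <= t j) /\ t n = x]].

Definition infF (R : realType) (p x : R) : R :=
  inf [set infFn p n x | n in [set n : nat | (1 <= n)%N]].

Definition is_maximum (R : realType) (E : set R) (m : R) : Prop :=
  E m /\ ubound E m.

(* The Landau notations expect a [filter_on]; the library packages [nbhs x] and
   [x^'] as such, but neither +oo nor x^'+. *)
Canonical pinfty_filter_on (R : numFieldType) :=
  FilterType (pinfty_nbhs R) (@proper_pinfty_nbhs R).

Canonical at_right_filter_on (R : realFieldType) (x : R) :=
  FilterType (at_right x) (at_right_proper_filter x).

(* Main.v *)
Require Import Defs.
From HB Require Import structures.
From mathcomp Require Import all_boot all_order all_algebra.
From mathcomp Require Import all_classical all_reals all_analysis.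
From mathcomp Require Import ring lra.
Set Implicit Arguments.
Unset Strict Implicit.
Unset Printing Implicit Defensive.
Import Order.TTheory GRing.Theory Num.Theory.
Import numFieldNormedType.Exports.
Local Open Scope classical_set_scope.
Local Open Scope ring_scope.

(* Put y_0 = 1, y_k = t_k + p and v_k = y_k / y_{k-1}.  Then
     e log (t_n + p) - S_n(t) = sum_k (p / y_{k-1} - phi v_k),
   where phi v = v - e log v >= 0 vanishes only at e.  Hence A(p) is the supremum
   of this gain over all finite sequences of ratios, without terminal condition.
   For p <= 1 ratios outside [1, e] never help, so that A is a supremum of
   increasing affine functions of p over a fixed index set: it is convex, strictly
   increasing and continuous, and satisfies A(p) = p + max_v (A(p/v) - phi v).
   The lower bound on F follows since e log y + A(p/y) is a potential for the sums;
   for the upper bound, a near-optimal sequence is cut when y reaches about log x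
   and continued to x + p by nearly equal ratios close to e, which costs O(1/log x). *)

(** * The cost [phi] of a ratio and its quadratic bounds *)

Local Notation e := (expR 1).

Lemma e_ge2 (R : realType) : 2 <= e :> R.
Proof. have := expR_ge1Dx (1 : R); lra. Qed.

Lemma e_gt0 (R : realType) : 0 < e :> R.
Proof. exact: expR_gt0. Qed.

Lemma ln_le_sub1 (R : realType) (x : R) : 0 < x -> ln x <= x - 1.
Proof.
move=> x0; have /le_ln1Dx : -1 < x - 1 by lra.
by rewrite addrC subrK.
Qed.

Definition phi (R : realType) (v : R) : R := v - e * ln v.

Lemma phi_e (R : realType) : phi e = 0 :> R.
Proof. by rewrite /phi expRK mulr1 subrr. Qed.

(** Convexity: the right side is the tangent at w, since phi'(w) = 1 - e/w. *)
Lemma phi_tangent (R : realType) (v w : R) : 0 < v -> 0 < w ->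
  phi v - phi w >= (w - v) * (e / w - 1).
Proof.
move=> v0 w0; rewrite /phi.
have := ln_le_sub1 (divr_gt0 v0 w0); rewrite ln_div ?posrE// => H.
have e0 := e_gt0 R.
have -> : (w - v) * (e / w - 1) = v - w - e * (v / w - 1).
  by field; rewrite gt_eqF.
have : e * (ln v - ln w) <= e * (v / w - 1) by rewrite ler_pM2l.
lra.
Qed.

Lemma phi_ge0 (R : realType) (v : R) : 0 < v -> 0 <= phi v.
Proof.
move=> v0; have := phi_tangent v0 (e_gt0 R).
by rewrite phi_e divff ?gt_eqF ?e_gt0// subrr mulr0 subr0.
Qed.

(** With v = e s^2 one gets phi v = e (s^2 - 1 - 2 ln s), and ln s <= s - 1. Measuring the distance
    through the square root makes the bound valid for every v > 0. *)
Lemma phi_ge_sqr (R : realType) (v : R) : 0 < v ->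
  e * (Num.sqrt (v / e) - 1) ^+ 2 <= phi v.
Proof.
move=> v0; have e0 := e_gt0 R; set s := Num.sqrt _.
have s0 : 0 < s by rewrite sqrtr_gt0 divr_gt0.
have sE : s ^+ 2 = v / e by rewrite sqr_sqrtr// ltW// divr_gt0.
have vE : v = e * s ^+ 2 by rewrite sE mulrCA divff ?mulr1// gt_eqF.
have lv : ln v = 1 + 2 * ln s.
  by rewrite vE lnM ?posrE ?exprn_gt0// expRK lnXn// mulr2n; ring.
rewrite /phi lv vE -subr_ge0.
have -> : e * s ^+ 2 - e * (1 + 2 * ln s) - e * (s - 1) ^+ 2
   = 2 * e * (s - 1 - ln s) by ring.
by rewrite pmulr_rge0 ?mulr_gt0// subr_ge0 ln_le_sub1.
Qed.

(** The left side is e (e^w - 1 - w), and e^w <= 1/(1 - w) <= 1 + w + w^2 because (1 + w + w^2)(1 -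
    w) = 1 - w^3 >= 1. *)
Lemma phi_le_sqr (R : realType) (w : R) : w <= 0 ->
  phi (expR (1 + w)) <= e * w ^+ 2.
Proof.
move=> w0; rewrite /phi expRK expRD.
have h : expR w * (1 - w) <= 1.
  rewrite -[leRHS](@expRxMexpNx_1 _ w) ler_pM2l ?expR_gt0//.
  exact: expR_ge1Dx.
have {}h : expR w <= 1 + w + w ^+ 2.
  rewrite -(@ler_pM2r _ (1 - w)); last by lra.
  apply: le_trans h _; nra.
have := e_gt0 R; nra.
Qed.

(** * The gain of a finite sequence of ratios *)

(** After a step of ratio v the current y is rescaled to 1, which turns p into p / v; the running
    parameter is thus p / y_{k-1}. *)
Fixpoint gain (R : realType) (p : R) (s : seq R) : R :=
  if s is v :: s' then p - phi v + gain (p / v) s' else 0.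

Definition ratios (R : realType) (s : seq R) : bool :=
  all (fun v => 1 <= v <= e) s.

Lemma ratios_cons (R : realType) (v : R) (s : seq R) :
  ratios (v :: s) = (1 <= v <= e) && ratios s.
Proof. by []. Qed.

Lemma ratiosP (R : realType) (v : R) (s : seq R) :
  ratios (v :: s) -> [/\ 1 <= v, v <= e, 0 < v & ratios s].
Proof. by move=> /andP[/andP[v1 ve] ss]; split=> //; lra. Qed.

Lemma prod_ratios_ge1 (R : realType) (s : seq R) :
  ratios s -> 1 <= \prod_(v <- s) v.
Proof.
elim: s => [|v s IH]; first by rewrite big_nil.
move=> /ratiosP[v1 _ _ /IH h]; rewrite big_cons; nra.
Qed.

Lemma gain_cat (R : realType) (p : R) (s s' : seq R) :
  gain p (s ++ s') = gain p s + gain (p / \prod_(v <- s) v) s'.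
Proof.
elim: s p => [|v s IH] p /=; first by rewrite big_nil divr1 add0r.
by rewrite IH big_cons addrA invfM mulrA.
Qed.

(** Makes the supremum finite, and shows that only O(p / L) can still be gained once y has reached
    L. *)
Lemma gain_le_linear (R : realType) (p : R) (s : seq R) :
  0 <= p <= 1 -> ratios s -> gain p s <= e ^+ 2 * p.
Proof.
elim: s p => [|v s IH] p /andP[p0 p1] /=.
  by move=> _; rewrite mulr_ge0 ?sqr_ge0.
move=> /ratiosP[v1 ve v0 ss].
have e2 := e_ge2 R.
have pv0 : 0 <= p / v by rewrite divr_ge0// ltW.
have pE : p = p / v * v by rewrite divfK ?gt_eqF.
have pv1 : p / v <= 1 by nra.
have := IH _ (introT andP (conj pv0 pv1)) ss.
suff : p <= phi v + e ^+ 2 * p - e ^+ 2 * (p / v) by lra.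
have f0 := phi_ge0 v0.
(* Multiplying by p <= 1 and using phi v >= 0 gives the goal. The inequality holds because e^2 (1 -
   1/v) >= e (v - 1) for v <= e, while e ln v <= e (v - 1). *)
suff : 1 <= phi v + e ^+ 2 * (1 - v^-1) by nra.
have lv := ln_le_sub1 v0; rewrite /phi.
have vE : v * v^-1 = 1 by rewrite divff ?gt_eqF.
have : e * (v - 1) <= e ^+ 2 * (1 - v^-1).
  rewrite expr2 -mulrA ler_pM2l ?e_gt0//.
  have -> : v - 1 = v * (1 - v^-1) by rewrite mulrBr mulr1 vE.
  rewrite ler_wpM2r//; nra.
nra.
Qed.

Lemma gain_mono (R : realType) (p q : R) (s : seq R) : p <= q -> ratios s ->
  gain p s <= gain q s.
Proof.
elim: s p q => [|v s IH] p q pq //= /ratiosP[v1 ve v0 ss].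
have : p / v <= q / v by rewrite ler_pM2r ?invr_gt0.
move/IH/(_ ss); lra.
Qed.

Lemma gain_convex (R : realType) (l p q : R) (s : seq R) :
  gain ((1 - l) * p + l * q) s = (1 - l) * gain p s + l * gain q s.
Proof.
elim: s p q => [|v s IH] p q /=; first by ring.
have -> : ((1 - l) * p + l * q) / v = (1 - l) * (p / v) + l * (q / v) by ring.
rewrite IH; ring.
Qed.

(** * The supremum of the gains: step inequality, convexity, functional equation *)

Definition gainsup (R : realType) (p : R) : R :=
  sup [set gain p s | s in [set s | ratios s]].

Lemma gain_le_gainsup (R : realType) (p : R) (s : seq R) :
  0 <= p <= 1 -> ratios s -> gain p s <= gainsup p.
Proof.
move=> p01 ss; apply: ub_le_sup; last by exists s.
by exists (e ^+ 2 * p) => _ [s' ss' <-]; exact: gain_le_linear.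
Qed.

Lemma gainsup_le (R : realType) (p M : R) :
  (forall s, ratios s -> gain p s <= M) -> gainsup p <= M.
Proof.
move=> h; apply: ge_sup; first by exists 0, [::].
by move=> _ [s ss <-]; exact: h.
Qed.

Lemma gainsup_ge0 (R : realType) (p : R) : 0 <= p <= 1 -> 0 <= gainsup p.
Proof. by move=> p01; exact: (@gain_le_gainsup _ p [::]). Qed.

Lemma gainsup_mono (R : realType) (p q : R) : p <= q -> 0 <= q <= 1 ->
  gainsup p <= gainsup q.
Proof.
move=> pq q01; apply: gainsup_le => s ss.
exact: le_trans (gain_mono pq ss) (gain_le_gainsup q01 ss).
Qed.

(* A step v < 1 is wasteful: since the next step v1 has v1 >= 1, the two steps
   may be merged into the single step v * v1. *)
Lemma gain_down_step (R : realType) (q v : R) (s : seq R) :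
  0 < q -> q <= v <= 1 -> ratios s ->
  gain (q / v) s + e * ln v <= gainsup q + v - q.
Proof.
move=> q0; elim: s v => [|v1 s IH] v /andP[qv v1'].
  move=> _ /=; have := ln_le0 v1'; have := @gainsup_ge0 _ q.
  have := e_gt0 R; nra.
move=> /ratiosP[v11 v1e v10 ss] /=.
have v0 : 0 < v by lra.
have rE : q / v / v1 = q / (v * v1) by rewrite invfM mulrA.
have lE : ln (v * v1) = ln v + ln v1 by rewrite lnM.
have r1 : q / v <= 1 by rewrite ler_pdivrMr// mul1r.
(* The merged ratio is either a legitimate first ratio or still below 1, where induction applies.
   Both cases reduce to q/v - 1 <= (v1 - 1)(1 - v), whose sides have opposite signs. *)
have [w1|w1] := leP 1 (v * v1).
  have := @gain_le_gainsup _ q (v * v1 :: s); rewrite /= rE /phi lE => H.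
  have : ratios (v * v1 :: s) by rewrite ratios_cons w1 ss andbT /=; nra.
  move=> /H {H}; nra.
have := IH (v * v1); rewrite rE lE /phi => H.
have : q <= v * v1 <= 1 by apply/andP; split; nra.
move=> /H /(_ ss); nra.
Qed.

(** All ratios v >= q must be allowed here, not only those in [1, e]: for q = p / y and v = y' / y
    the condition reads y' >= p, that is, the next term is nonnegative. *)
Lemma gainsup_step (R : realType) (q v : R) : 0 < q <= 1 -> q <= v ->
  q - phi v + gainsup (q / v) <= gainsup q.
Proof.
move=> /andP[q0 q1] qv; have v0 : 0 < v by lra.
have q01 : 0 <= q <= 1 by rewrite ltW.
suff : gainsup (q / v) <= gainsup q - (q - phi v) by lra.
apply: gainsup_le => s ss.
have [v1|v1] := leP v 1.
  have := @gain_down_step _ q v s q0; rewrite qv v1 => /(_ isT ss).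
  rewrite /phi; lra.
have [ve|ve] := leP v e.
  have := gain_le_gainsup q01 (s := v :: s); rewrite ratios_cons ss ve (ltW v1).
  by move=> /(_ isT) /=; lra.
(* A ratio above e is replaced by e: the cost drops to 0 and the next parameter grows. *)
have := gain_le_gainsup q01 (s := e :: s); rewrite ratios_cons ss lexx /= phi_e.
have e2 := e_ge2 R; have -> : 1 <= e :> R by lra.
move=> /(_ isT).
have : gain (q / v) s <= gain (q / e) s.
  by apply: gain_mono => //; rewrite ler_pM2l// lef_pV2 ?posrE ?e_gt0// ltW.
have := phi_ge0 v0; lra.
Qed.

Lemma gainsup_ge (R : realType) (p : R) : 0 < p <= 1 ->
  p + gainsup (p / e) <= gainsup p.
Proof.
move=> p01; have e2 := e_ge2 R.
have := @gainsup_step _ p e p01; rewrite phi_e subr0; apply; lra.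
Qed.

Lemma gainsup_ge_id (R : realType) (p : R) : 0 < p <= 1 -> p <= gainsup p.
Proof.
move=> p01; apply: le_trans (gainsup_ge p01); rewrite lerDl gainsup_ge0//.
have e2 := e_ge2 R; rewrite divr_ge0 ?ler_pdivrMr/=; lra.
Qed.

(** The first step of a nonempty sequence contributes p itself and the rest is monotone in p, so the
    slope is at least 1; the empty sequence is covered by [gainsup_ge_id]. *)
Lemma gainsup_incr (R : realType) (p q : R) : 0 < p -> p <= q -> q <= 1 ->
  gainsup p + (q - p) <= gainsup q.
Proof.
move=> p0 pq q1; rewrite -lerBrDr; apply: gainsup_le => -[|v s].
  have := @gainsup_ge_id _ q; rewrite /=; lra.
move=> vs; have := @gain_le_gainsup _ q _ _ vs => /=.
move: vs => /ratiosP[_ _ v0 ss].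
have : gain (p / v) s <= gain (q / v) s.
  by apply: gain_mono => //; rewrite ler_pM2r// invr_gt0.
lra.
Qed.

Lemma gainsup_convex (R : realType) (l p q : R) :
  0 <= l <= 1 -> 0 <= p <= 1 -> 0 <= q <= 1 ->
  gainsup ((1 - l) * p + l * q) <= (1 - l) * gainsup p + l * gainsup q.
Proof.
move=> /andP[l0 l1] p01 q01; apply: gainsup_le => s ss; rewrite gain_convex.
have := gain_le_gainsup p01 ss; have := gain_le_gainsup q01 ss.
move=> h1 h2; nra.
Qed.

Lemma gainsup0 (R : realType) : gainsup 0 = 0 :> R.
Proof.
apply/eqP; rewrite eq_le gainsup_ge0 ?lexx ?ler01// andbT.
apply: gainsup_le => s /gain_le_linear; rewrite -[leRHS](mulr0 (e ^+ 2)).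
by apply; rewrite lexx ler01.
Qed.

(** Convexity between 0 and p, with value 0 at 0. *)
Lemma gainsup_div (R : realType) (p v : R) : 0 <= p <= 1 -> 1 <= v ->
  gainsup (p / v) <= gainsup p / v.
Proof.
move=> p01 v1; have v0 : 0 < v by lra.
have := @gainsup_convex _ v^-1 0 p.
rewrite mulr0 add0r gainsup0 mulr0 add0r mulrC [X in _ -> _ -> _ -> _ <= X]mulrC.
by apply=> //; rewrite ?lexx ?ler01// invr_ge0 ltW//= invf_le1.
Qed.

(** By convexity the slope on [p, q] is at most that of the chord from p to 1. *)
Lemma gainsup_lipschitz (R : realType) (r p q : R) :
  0 < p -> p <= q -> q <= r -> r < 1 ->
  gainsup q - gainsup p <= gainsup 1 / (1 - r) * (q - p).
Proof.
move=> p0 pq qr r1; set l := (q - p) / (1 - p).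
have lE : (1 - p) * l = q - p by rewrite mulrC divfK// gt_eqF//; lra.
have l0 : 0 <= l by apply: divr_ge0; lra.
have l1 : l <= 1 by rewrite ler_pdivrMr; lra.
have := @gainsup_convex _ l p 1.
have -> : (1 - l) * p + l * 1 = q by lra.
rewrite l0 l1 ltW//= lexx ler01.
move=> /(_ isT) /(_ _ isT).
have A0 : 0 <= gainsup p by apply: gainsup_ge0; lra.
have A1 : 0 <= gainsup 1 :> R by apply: gainsup_ge0; lra.
have lle : l <= (1 - r)^-1 * (q - p).
  rewrite /l mulrC ler_wpM2r ?subr_ge0// lef_pV2 ?posrE; lra.
have := ler_wpM2l A1 lle; rewrite mulrA; move=> h1 h2.
have : p <= 1 by lra.
move=> /h2; nra.
Qed.

Lemma gainsup_continuous (R : realType) (p : R) : 0 < p < 1 ->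
  {for p, continuous (@gainsup R)}.
Proof.
move=> /andP[p0 p1]; apply/cvgrPdist_le => /= eps eps0.
pose r := (1 + p) / 2; pose K := gainsup 1 / (1 - r) + 1.
have r1 : r < 1 by rewrite /r; lra.
have pr : p < r by rewrite /r; lra.
have K0 : 0 < K.
  rewrite /K ltr_wpDl// divr_ge0 ?gainsup_ge0 ?lexx ?ler01//; lra.
near=> q.
have q0 : 0 < q by near: q; exact: lt_nbhsr.
have qr : q < r by near: q; exact: lt_nbhsl.
have dist : K * `|p - q| <= eps.
  rewrite mulrC -ler_pdivlMr//; near: q.
  by apply: cvgr_dist_le => //; exact: divr_gt0.
have H a b : 0 < a -> a <= b -> b <= r ->
    `|gainsup a - gainsup b| <= K * `|a - b|.
  move=> a0 ab br; rewrite distrC (distrC a) !ger0_norm ?subr_ge0//; last first.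
    by apply: gainsup_mono => //; lra.
  have := gainsup_lipschitz a0 ab br r1; rewrite /K; lra.
apply: le_trans dist; have [pq|qp] := leP p q; first by apply: H => //; lra.
by rewrite distrC (distrC p); apply: H => //; lra.
Unshelve. all: by end_near. Qed.

(** The maximiser exists by continuity on [1, e]; splitting off the first ratio of a sequence gives
    one inequality, [gainsup_step] the other. *)
Lemma gainsup_functional (R : realType) (p : R) : 0 < p < 1 ->
  exists2 v : R, 1 <= v <= e
    & gainsup p = p - phi v + gainsup (p / v).
Proof.
move=> /andP[p0 p1]; have e2 := e_ge2 R.
have [||v] := @EVT_max R (fun v => gainsup (p / v) - phi v) 1 e.
- lra.
- apply/continuous_in_subspaceT => v; rewrite inE /= in_itv /= => /andP[v1 ve].
  have v0 : 0 < v by lra.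
  apply: cvgB; last first.
    apply: cvgB; first exact: cvg_id.
    by apply: cvgMr; exact: continuous_ln.
  apply: (@cvg_comp _ _ _ (fun v => p / v) (@gainsup R) _ (nbhs (p / v))).
    by apply: cvgMr; apply: cvgV; [rewrite gt_eqF | exact: cvg_id].
  by apply: gainsup_continuous; rewrite divr_gt0//= ltr_pdivrMr//; lra.
rewrite in_itv /= => v1e vmax; exists v => //.
have /andP[v1 ve] := v1e.
apply/eqP; rewrite eq_le; apply/andP; split; last first.
  by apply: gainsup_step; lra.
apply: gainsup_le => -[|w s] /=.
  (* The empty sequence has no first ratio; it is beaten by the choice v = e, which costs
     nothing. *)
  have := vmax e; rewrite in_itv /= lexx andbT phi_e subr0 => H.
  have : 1 <= e :> R by lra.
  move=> /H {H}; suff : 0 <= gainsup (p / e) by lra.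
  by rewrite gainsup_ge0// divr_ge0 ?ler_pdivrMr//; lra.
move=> /ratiosP[w1 we w0 ss].
have := vmax w; rewrite in_itv /= w1 we => /(_ isT).
suff : gain (p / w) s <= gainsup (p / w) by lra.
apply: gain_le_gainsup => //.
by rewrite divr_ge0 ?ler_pdivrMr//; lra.
Qed.

(** * Behaviour of the supremum as p tends to 0 *)

(** The sum of the geometric series of e^-k: the gain per unit of p when all ratios equal e. *)
Definition gain_slope {R : realType} : R := (1 - e^-1)^-1.

Lemma inv_e_bounds (R : realType) : 0 < (e^-1 : R) <= 2^-1.
Proof. by rewrite invr_gt0 e_gt0/= lef_pV2 ?posrE ?e_gt0// e_ge2. Qed.

Lemma gain_slopeE (R : realType) : gain_slope * (1 - e^-1) = 1 :> R.
Proof. by rewrite mulVf// gt_eqF//; have := inv_e_bounds R; lra. Qed.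

Lemma gain_slope_gt0 (R : realType) : 0 < gain_slope :> R.
Proof. by rewrite invr_gt0; have := inv_e_bounds R; lra. Qed.

(* gain_slope * p - gainsup p does not decrease under p |-> p / e. *)
Lemma gainsup_ge_slope (R : realType) (p : R) : 0 < p <= 1 ->
  gain_slope * p <= gainsup p.
Proof.
move=> p01; have cE := gain_slopeE R; have /andP[e0 e1] := inv_e_bounds R.
have c0 := gain_slope_gt0 R.
have H n : 0 < p * e^-1 ^+ n <= 1 /\
   gain_slope * p - gainsup p <=
   gain_slope * (p * e^-1 ^+ n) - gainsup (p * e^-1 ^+ n).
  elim: n => [|n [q01 IH]]; first by rewrite expr0 mulr1.
  have -> : p * e^-1 ^+ n.+1 = p * e^-1 ^+ n / e by rewrite exprSr mulrA.
  set q := p * _ in q01 IH *.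
  case/andP: (q01) => q0 q1; split; first by rewrite mulr_gt0//= mulr_ile1 ?(ltW q0) ?(ltW e0)//; lra.
  by apply: (le_trans IH); have := gainsup_ge q01; nra.
rewrite -subr_le0; apply/ler_addgt0Pr => d d0; rewrite add0r.
have [n nd] : exists n : nat, gain_slope / d < n%:R.
  by exists (Num.truncn (gain_slope / d)).+1; rewrite truncnS_gt.
have [q01 h] := H n; apply: (le_trans h).
have q0 : 0 <= gainsup (p * e^-1 ^+ n).
  by apply: gainsup_ge0; case/andP: q01 => /ltW -> ->.
suff : gain_slope * (p * e^-1 ^+ n) <= d by lra.
(* From e^n >= 1 + n: the remainder is at most [gain_slope * p / n], hence at most d. *)
have en : n%:R * e^-1 ^+ n <= 1 :> R.
  rewrite exprVn ler_pdivrMr ?exprn_gt0 ?e_gt0// mul1r -expRM_natl mulr1.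
  by apply: le_trans (expR_ge1Dx _); rewrite lerDr.
have {}nd : gain_slope <= n%:R * d by rewrite -ler_pdivrMr// ltW.
have en0 : 0 <= e^-1 ^+ n :> R by rewrite exprn_ge0// invr_ge0 ltW ?e_gt0.
apply: (@le_trans _ _ (n%:R * d * e^-1 ^+ n)); last by nra.
apply: ler_pM => //; [exact: ltW | |]; nra.
Qed.

(* At an optimal first step v, convexity gives gainsup p * (1 - 1/v) <= p - phi v,
   which forces v close to e when p is small. *)
Lemma gainsup_le_slope (R : realType) (eps : R) : 0 < eps ->
  exists2 d : R, 0 < d & forall p, 0 < p < d ->
    p < 1 /\ gainsup p <= (gain_slope + eps) * p.
Proof.
move=> eps0; have cE := gain_slopeE R; have /andP[e0 e1] := inv_e_bounds R.
have c0 := gain_slope_gt0 R; have e2 := e_ge2 R.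
(* Chosen so that 1/v - 1/e <= 2 eta yields (gain_slope + eps)(1 - 1/v) >= 1. *)
pose eta : R := eps * (1 - e^-1) / (2 * (gain_slope + eps)).
have eta0 : 0 < eta by rewrite divr_gt0 ?mulr_gt0//; lra.
have etaE : 2 * eta * (gain_slope + eps) = eps * (1 - e^-1).
  by rewrite /eta; field; lra.
exists (Num.min 1 (eta ^+ 2)); first by rewrite lt_min ltr01 exprn_gt0.
move=> p /andP[p0]; rewrite lt_min => /andP[p1 peta]; split=> //.
have [|v /andP[v1 ve] AE] := @gainsup_functional _ p; first by rewrite p0.
have v0 : 0 < v by lra.
have p01 : 0 <= p <= 1 by lra.
have Av := gainsup_div p01 v1.
have A0 := gainsup_ge0 p01.
have iv : 0 < v^-1 by rewrite invr_gt0.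
have vE : v * v^-1 = 1 by rewrite divff// gt_eqF.
have iv1 : v^-1 <= 1 by nra.
have f0 := phi_ge0 v0.
have Ap : gainsup p * (1 - v^-1) <= p - phi v by lra.
have fp : phi v <= p by nra.
have := phi_ge_sqr v0; set s := Num.sqrt _ => hs.
have s0 : 0 <= s by rewrite sqrtr_ge0.
have sE : s ^+ 2 = v * e^-1 by rewrite sqr_sqrtr// ltW// divr_gt0// e_gt0.
have ee : e * e^-1 = 1 :> R by rewrite divff// gt_eqF// e_gt0.
have s1 : s <= 1 by rewrite -sqrtr1 ler_sqrt ?ler01// ler_pdivrMr ?mul1r ?e_gt0.
have seta : 1 - s <= eta.
  rewrite -(@ler_pXn2r _ 2) ?nnegrE ?subr_ge0// ?ltW//.
  have : (1 - s) ^+ 2 = (s - 1) ^+ 2 by ring.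
  have := sqr_ge0 (s - 1); nra.
(* As s^2 = v/e, the difference is (1 - s^2)/v, with 1/v <= 1 and 1 - s^2 <= 2 (1 - s). *)
have ivb : v^-1 - e^-1 <= 2 * eta.
  have -> : v^-1 - e^-1 = v^-1 * (1 - s ^+ 2).
    by rewrite sE mulrBr mulr1 mulrA [_ * v]mulrC vE mul1r.
  have : 0 <= 1 - s ^+ 2 by nra.
  nra.
have key : 1 <= (gain_slope + eps) * (1 - v^-1) by nra.
have w0 : 0 < 1 - v^-1 by nra.
rewrite -(ler_pM2r w0); apply: (le_trans Ap); nra.
Qed.

(** * The sums, their infimum, and scaling for p > 1 *)

Lemma sumS1 (R : realType) (p : R) (t : nat -> R) : sumS p 1 t = t 1%N.
Proof. by rewrite /sumS big_geq// addr0. Qed.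

Lemma sumSS (R : realType) (p : R) (n : nat) (t : nat -> R) :
  sumS p n.+2 t = sumS p n.+1 t + t n.+2 / (t n.+1 + p).
Proof. by rewrite /sumS big_nat_recr//= addrA. Qed.

Lemma sumS_ge0 (R : realType) (p : R) (n : nat) (t : nat -> R) : 0 < p ->
  (forall j, (1 <= j <= n.+1)%N -> 0 <= t j) -> 0 <= sumS p n.+1 t.
Proof.
move=> p0; elim: n => [|n IH] t0; first by rewrite sumS1 t0.
rewrite sumSS addr_ge0//.
  by apply: IH => j /andP[j1 jn]; rewrite t0// j1 ltnW.
by rewrite divr_ge0 ?t0 ?leqnn// addr_ge0 ?t0 ?leqnSn// ltW.
Qed.

Lemma infF_le_sumS (R : realType) (p x : R) (n : nat) (t : nat -> R) : 0 < p ->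
  (forall j, (1 <= j <= n.+1)%N -> 0 <= t j) -> t n.+1 = x ->
  infF p x <= sumS p n.+1 t.
Proof.
move=> p0 t0 tx; have x0 : 0 <= x by rewrite -tx t0// leqnn.
(* Nonnegativity bounds both nested sets below, so that each [inf] is a true infimum. *)
have S0 m t' : (forall j, (1 <= j < m)%N -> 0 <= t' j) /\ t' m = x ->
    (1 <= m)%N -> 0 <= sumS p m t'.
  case: m => // m [h1 h2] _; apply: sumS_ge0 => // j /andP[j1].
  by rewrite leq_eqVlt => /predU1P[->|jm]; rewrite ?h2// h1// j1.
apply: (@le_trans _ _ (infFn p n.+1 x)).
  apply: ge_inf; last by exists n.+1.
  exists 0 => _ [m /= m1 <-]; apply: lb_le_inf.
    by exists (sumS p m (fun=> x)), (fun=> x).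
  by move=> _ [t' ht <-]; exact: S0.
apply: ge_inf; first by exists 0 => _ [t' ht <-]; exact: S0.
by exists t => //; split=> // j /andP[j1 jn]; rewrite t0// j1 ltnW.
Qed.

Lemma infF_ge (R : realType) (p x M : R) : 0 <= x ->
  (forall n t, (forall j, (1 <= j <= n.+1)%N -> 0 <= t j) -> t n.+1 = x ->
     M <= sumS p n.+1 t) ->
  M <= infF p x.
Proof.
move=> x0 h; apply: lb_le_inf; first by exists (infFn p 1 x), 1%N.
move=> _ [[|m] //= _ <-]; apply: lb_le_inf.
  by exists (sumS p m.+1 (fun=> x)), (fun=> x).
move=> _ [t [t0 tx] <-]; apply: h => // j /andP[j1].
by rewrite leq_eqVlt => /predU1P[->|jm]; rewrite ?tx// t0// j1.
Qed.

(** Dividing all terms by p preserves the quotients and only shrinks the first term; conversely, an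
    initial zero makes the first term of the shorter sequence a quotient. *)
Lemma infF_scale (R : realType) (p x : R) : 1 < p -> 0 < x ->
  infF p x = infF 1 (x / p).
Proof.
move=> p1 x0; have p0 : 0 < p by lra.
have pn0 : p != 0 by rewrite gt_eqF.
apply/eqP; rewrite eq_le; apply/andP; split.
  apply: infF_ge => [|n t t0 tx]; first by rewrite divr_ge0// ltW.
  (* The second term of [t'] contributes p t_1 / (0 + p) = t_1, so no cost is added. *)
  pose t' j := if (j <= 1)%N then 0 else p * t j.-1.
  have -> : sumS 1 n.+1 t = sumS p n.+2 t'.
    elim: n {t0 tx} => [|n IH].
      by rewrite sumSS !sumS1 /t' /= !add0r mulrAC divff// mul1r.
    rewrite sumSS IH [RHS]sumSS; congr (_ + _); rewrite /t' /=.
    by rewrite -[X in _ = _ / (_ + X)]mulr1 -mulrDr -mulf_div divff// mul1r.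
  apply: infF_le_sumS => //; last by rewrite /t' /= tx mulrC divfK.
  move=> [|[|j]] //= jn; rewrite /t' /= mulr_ge0 ?(ltW p0)// t0//.
apply: infF_ge => [|n t t0 tx]; first exact: ltW.
apply: (@le_trans _ _ (sumS 1 n.+1 (fun j => t j / p))).
  apply: infF_le_sumS => [//|j jn|]; last by rewrite tx.
  by rewrite divr_ge0 ?t0// ltW.
elim: n t0 {tx} => [|n IH] t0.
  rewrite !sumS1 ler_pdivrMr//; have := t0 1%N isT; nra.
rewrite !sumSS lerD//.
  by apply: IH => j /andP[j1 jn]; rewrite t0// j1 ltnW.
have t1 : 0 <= t n.+1 by rewrite t0//= leqnSn.
rewrite le_eqVlt; apply/orP; left; apply/eqP.
field; rewrite pn0/=; apply/andP; split; lra.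
Qed.

(** * Lower bound on the infimum *)

(** This is [gainsup_step] at q = p / y, v = y' / y; the last summand is the quotient that enters
    the sum. *)
Lemma gainsup_potential (R : realType) (p y y' : R) :
  0 < p -> p <= y -> p <= y' ->
  e * ln y' + gainsup (p / y') <= e * ln y + gainsup (p / y) + (y' - p) / y.
Proof.
move=> p0 py py'; have [y0 y'0] : 0 < y /\ 0 < y' by lra.
have := @gainsup_step _ (p / y) (y' / y).
rewrite ler_pM2r ?invr_gt0// divr_gt0// ler_pdivrMr// mul1r => /(_ py py').
have -> : p / y / (y' / y) = p / y' by field; rewrite !gt_eqF.
rewrite /phi ln_div ?posrE//; lra.
Qed.

(** The potential telescopes from y_0 = 1, an admissible start because p <= 1; the first term fits
    as (y_1 - p) / y_0. *)
Lemma sumS_ge (R : realType) (p : R) (n : nat) (t : nat -> R) : 0 < p <= 1 ->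
  (forall j, (1 <= j <= n.+1)%N -> 0 <= t j) ->
  e * ln (t n.+1 + p) + gainsup (p / (t n.+1 + p)) - gainsup p
    <= sumS p n.+1 t.
Proof.
move=> /andP[p0 p1]; elim: n => [|n IH] t0.
  have := @gainsup_potential _ p 1 (t 1%N + p) p0 p1.
  rewrite lerDr t0// ln1 mulr0 add0r !divr1 addrK sumS1 => /(_ isT); lra.
have := @gainsup_potential _ p (t n.+1 + p) (t n.+2 + p) p0.
rewrite !lerDr !t0 ?leqnn ?leqnSn// addrK => /(_ isT isT) h.
have : forall j, (1 <= j <= n.+1)%N -> 0 <= t j.
  by move=> j /andP[j1 jn]; rewrite t0// j1 ltnW.
move=> /IH; rewrite sumSS; lra.
Qed.

Lemma infF_lower (R : realType) (p x : R) : 0 < p <= 1 -> 0 < x ->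
  e * ln x - gainsup p <= infF p x.
Proof.
move=> p01 x0; have /andP[p0 p1] := p01.
apply: infF_ge => [|n t t0 tx]; first exact: ltW.
apply: le_trans (sumS_ge p01 t0); rewrite tx.
have : e * ln x <= e * ln (x + p).
  by rewrite ler_pM2l ?e_gt0// ler_ln ?posrE ?addr_gt0// lerDl ltW.
suff : 0 <= gainsup (p / (x + p)) by lra.
by apply: gainsup_ge0; rewrite divr_ge0 ?ler_pdivrMr; lra.
Qed.

(** * Upper bound on the infimum *)

Lemma infF_le_gain (R : realType) (p x : R) (s : seq R) : 0 < p <= 1 ->
  ratios s -> s != [::] -> \prod_(v <- s) v = x + p ->
  infF p x <= e * ln (x + p) - gain p s.
Proof.
move=> /andP[p0 p1] ss sn0 sx.
(* The partial products are the y_k; they are at least 1 >= p, so the terms are nonnegative. *)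
pose t k := \prod_(v <- take k s) v - p.
have ss' k : ratios (take k s).
  by move: ss; rewrite -{1}(cat_take_drop k s) /ratios all_cat => /andP[].
have P1 k : 1 <= \prod_(v <- take k s) v by exact: prod_ratios_ge1.
have takeS k : (k < size s)%N -> take k.+1 s = take k s ++ [:: nth 1 s k].
  by move=> ks; rewrite (take_nth 1)// cats1.
have nth_gt0 k : (k < size s)%N -> 0 < nth 1 s k.
  by move=> ks; have /andP[] := all_nthP 1 ss k ks; lra.
have tE n : (n < size s)%N -> sumS p n.+1 t =
    e * ln (\prod_(v <- take n.+1 s) v) - gain p (take n.+1 s).
  elim: n => [|n IH] ns.
    rewrite sumS1 /t takeS// take0 /= big_seq1 /phi; lra.
  rewrite sumSS IH ?(ltnW ns)// /t subrK [in RHS]takeS// gain_cat.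
  rewrite [take n.+2 s]takeS// big_cat big_seq1 /=.
  have n0 := nth_gt0 _ ns; have := P1 n.+1.
  set P := \prod_(v <- _) v; set w := nth _ _ _ in n0 * => P1'.
  have P0 : 0 < P by lra.
  rewrite lnM ?posrE// mulrBl mulrAC divff ?gt_eqF// mul1r /phi; lra.
have := sn0; rewrite -size_eq0; case sE: (size s) => [//|n] _.
have nE : take n.+1 s = s by rewrite -sE take_size.
rewrite -sx -[in leRHS]nE -tE ?sE//; apply: infF_le_sumS => //.
  by move=> j _; rewrite /t subr_ge0 (le_trans p1).
by rewrite /t nE sx addrK.
Qed.

(** Cut just after the product first reaches L: the last ratio overshoots by a factor at most e, and
    [gain_le_linear] bounds the discarded tail. *)
Lemma gain_truncate (R : realType) (p L : R) (s : seq R) :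
  0 < p <= 1 -> 1 <= L -> ratios s ->
  exists s', [/\ ratios s', \prod_(v <- s') v <= e * L
               & gain p s <= gain p s' + e ^+ 2 * (p / L)].
Proof.
elim: s p L => [|v s IH] p L /andP[p0 p1] L1.
  move=> _; exists [::]; split => //.
    rewrite big_nil; have := e_ge2 R; nra.
  by rewrite add0r mulr_ge0 ?sqr_ge0// divr_ge0//; lra.
move=> vss; have /ratiosP[v1 ve v0 ss] := vss.
have L0 : 0 < L by lra.
have pv1 : p / v <= 1 by rewrite ler_pdivrMr//; lra.
have pv0 : 0 < p / v by rewrite divr_gt0.
have [Lv|vL] := leP L v.
  exists [:: v]; split.
  - by rewrite ratios_cons v1 ve.
  - by rewrite big_seq1; have := e_gt0 R; nra.
  have /= : gain (p / v) s <= e ^+ 2 * (p / v).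
    by apply: gain_le_linear => //; rewrite ltW.
  have : e ^+ 2 * (p / v) <= e ^+ 2 * (p / L).
    by rewrite ler_wpM2l ?sqr_ge0// ler_pM2l// lef_pV2.
  lra.
have [||s' [ss' ps' gs']] := IH (p / v) (L / v) _ _ ss.
- by rewrite pv0.
- by rewrite ler_pdivlMr// mul1r ltW.
exists (v :: s'); split.
- by rewrite ratios_cons v1 ve.
- by rewrite big_cons mulrC -ler_pdivlMr// -mulrA.
move: gs'; have -> : p / v / (L / v) = p / L by field; rewrite !gt_eqF.
rewrite /=; lra.
Qed.

Lemma gain_nseq_ge (R : realType) (q v : R) (n : nat) : 0 <= q -> 0 < v ->
  - (n%:R * phi v) <= gain q (nseq n v).
Proof.
move=> q0 v0; elim: n q q0 => [|n IH] q q0 /=; first by rewrite mul0r oppr0.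
have := IH (q / v); rewrite divr_ge0 ?(ltW v0)// => /(_ isT).
rewrite -natr1; lra.
Qed.

(* n nearly equal steps of ratio (slightly below) e, with n = ceil (ln Z), each
   costing O(1/n^2). *)
Lemma gain_fill (R : realType) (q Z : R) : 0 <= q -> 1 < Z ->
  exists s, [/\ ratios s, s != [::], \prod_(v <- s) v = Z
              & - (e / ln Z) <= gain q s].
Proof.
move=> q0 Z1; have Z0 : 0 < Z by lra.
have lZ : 0 < ln Z by rewrite ln_gt0.
have := truncnS_gt (ln Z); have := truncn_le (ln Z); rewrite (ltW lZ).
set m := Num.truncn _; move=> h1 h2.
pose n : R := m.+1%:R; have nE : n = m%:R + 1 by rewrite /n natr1.
have n0 : 0 < n by rewrite ltr0n.
(* The common ratio is exp(1 + w) with -1/n <= w <= 0, so the product is exactly Z and the total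
   cost is at most n e w^2 <= e/n. *)
pose w := ln Z / n - 1.
have wE : (1 + w) * n = ln Z by rewrite /w addrC subrK divfK// gt_eqF.
have m0 : 0 <= m%:R :> R by rewrite ler0n.
have w0 : w <= 0 by rewrite /w subr_le0 ler_pdivrMr//; lra.
have w1 : 0 <= 1 + w by rewrite /w addrC subrK divr_ge0// ltW.
exists (nseq m.+1 (expR (1 + w))); split => //.
- apply/allP => v; rewrite mem_nseq => /andP[_ /eqP ->].
  have := expR_ge1Dx (1 + w); rewrite ler_expR; lra.
- rewrite big_nseq -[RHS](lnK (x := Z)) ?posrE// -wE mulrC /n expRM_natl.
  by elim: (m.+1) => [|k IH] /=; rewrite ?expr0// IH exprS.
apply: le_trans (gain_nseq_ge _ q0 (expR_gt0 _)); rewrite lerN2 -/n.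
have nw : n * w = ln Z - n by lra.
have nw2 : n * w ^+ 2 * n <= 1.
  have -> : n * w ^+ 2 * n = (n - ln Z) ^+ 2.
    by rewrite -(opprB (ln Z)) sqrrN -nw; ring.
  rewrite expr_le1//; lra.
have f := phi_le_sqr w0.
apply: (@le_trans _ _ (e / n)); last first.
  by rewrite ler_pM2l ?e_gt0// lef_pV2 ?posrE//; lra.
rewrite ler_pdivlMr//.
apply: (@le_trans _ _ (n * (e * w ^+ 2) * n)).
  by rewrite ler_pM2r// ler_pM2l.
have -> : n * (e * w ^+ 2) * n = e * (n * w ^+ 2 * n) by ring.
by rewrite ler_piMr// ltW// e_gt0.
Qed.

(** In the constant, 1 pays for near-optimality, e^2 for truncation at L = ln x, e for replacing ln
    (x + p) by ln x, and 2e for the final filling. *)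
Lemma infF_upper (R : realType) (p x : R) : 0 < p <= 1 -> 8 <= ln x ->
  infF p x <= e * ln x - gainsup p + (1 + e ^+ 2 + 3 * e) / ln x.
Proof.
move=> p01 u8; have /andP[p0 p1] := p01; set u := ln x.
have u0 : 0 < u by rewrite /u; lra.
have x0 : 0 < x by rewrite ltNge; apply/negP => /ln0 h; lra.
have e0 := e_gt0 R.
have ui : 0 < u^-1 by rewrite invr_gt0.
have [s ss hs] : exists2 s, ratios s & gainsup p - u^-1 < gain p s.
  have p01' : 0 <= p <= 1 by rewrite ltW.
  have [|_ [s ss <-] h] := @sup_adherent _ [set gain p s | s in [set s | ratios s]] _ ui.
    split; first by exists 0, [::].
    by exists (gainsup p) => _ [s' ss' <-]; exact: gain_le_gainsup.
  by exists s.
have u1 : 1 <= u by rewrite /u; lra.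
have [s1 [ss1 ps1 gs1]] := gain_truncate p01 u1 ss.
set P := \prod_(v <- s1) v in ps1; have P1 : 1 <= P := prod_ratios_ge1 ss1.
have P0 : 0 < P by lra.
have xp0 : 0 < x + p by lra.
(* From ln P <= 1 + ln u and ln u <= u/4 + 1 the logarithm is at least 3u/4 - 2, which is at least
   u/2 exactly when u >= 8. *)
have lZ : u / 2 <= ln ((x + p) / P).
  rewrite ln_div ?posrE//.
  have : u <= ln (x + p) by rewrite ler_ln ?posrE// lerDl ltW.
  have : ln P <= 1 + ln u.
    by rewrite -[X in X + _](@expRK R) -lnM ?posrE ?e_gt0// ler_ln ?posrE// mulr_gt0.
  have := @ln_le_sub1 _ (u / 4) ltac:(lra); rewrite ln_div ?posrE//.
  have : ln 4 <= 2 :> R.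
    have -> : 4 = 2 ^+ 2 :> R by ring.
    by rewrite lnXn// mulr2n; have := @ln_le_sub1 R 2 ltac:(lra); lra.
  rewrite -/u in u8; lra.
have Z1 : 1 < (x + p) / P.
  rewrite -ltr_ln ?posrE ?divr_gt0// ln1; lra.
have [|s2 [ss2 s2n ps2 gs2]] := @gain_fill _ (p / P) _ _ Z1.
  by rewrite divr_ge0// ltW.
have := @infF_le_gain _ p x (s1 ++ s2) p01.
rewrite {1}/ratios all_cat -/(ratios s1) -/(ratios s2) ss1 ss2 => /(_ isT).
rewrite -size_eq0 size_cat addn_eq0 negb_and !size_eq0 s2n orbT => /(_ isT).
rewrite big_cat /= ps2 mulrC divfK ?gt_eqF// => /(_ erefl).
rewrite gain_cat -/P => H; apply: (le_trans H).
have xu : u <= x by have := ln_le_sub1 x0; rewrite -/u; lra.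
have lxp : ln (x + p) <= u + u^-1.
  have -> : x + p = x * (1 + p / x) by field; rewrite gt_eqF.
  have px : 0 < p / x by rewrite divr_gt0.
  rewrite lnM ?posrE//; last by lra.
  rewrite lerD2l; apply: (le_trans (le_ln1Dx _)); first by lra.
  rewrite -[leRHS]mul1r; apply: ler_pM => //; rewrite ?invr_ge0 ?(ltW p0) ?(ltW x0)//.
  by rewrite lef_pV2.
have elxp : e * ln (x + p) <= e * (u + u^-1) by rewrite ler_pM2l.
have e2u : e / ln ((x + p) / P) <= 2 * e * u^-1.
  have -> : 2 * e * u^-1 = e / (u / 2) by field; rewrite gt_eqF.
  by rewrite ler_pM2l// lef_pV2 ?posrE//; lra.
have pu : e ^+ 2 * (p / u) <= e ^+ 2 * u^-1.
  rewrite ler_wpM2l ?sqr_ge0//; nra.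
rewrite /u in hs gs1 elxp e2u pu *; lra.
Qed.

(** * The function A for all p, and the final assembly *)

(** This is A(p); beyond 1 its form is forced by [infF_scale] and ln (x / p) = ln x - ln p. *)
Definition deficit (R : realType) (p : R) : R :=
  if p <= 1 then gainsup p else gainsup 1 + e * ln p.

Lemma infF_asymptotics (R : realType) (p : R) : 0 < p ->
  exists U : R, forall x, expR U <= x -> 0 < ln x /\
    `|infF p x - (e * ln x - deficit p)| <= 2 * (1 + e ^+ 2 + 3 * e) / ln x.
Proof.
set K : R := 1 + e ^+ 2 + 3 * e.
have K0 : 0 < K by have := e_gt0 R; have := sqr_ge0 (e : R); rewrite /K; lra.
have bound (q x : R) : 0 < q <= 1 -> 8 <= ln x ->
    `|infF q x - (e * ln x - gainsup q)| <= K / ln x.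
  move=> q01 x8; have x0 : 0 < x.
    by rewrite ltNge; apply/negP => /ln0 h; lra.
  have := infF_lower q01 x0; have := infF_upper q01 x8; rewrite -/K => h1 h2.
  rewrite ger0_norm; lra.
move=> p0; rewrite /deficit; have [p1|p1] := leP p 1.
  exists 8 => x x8.
  have x0 : 0 < x by apply: lt_le_trans x8; exact: expR_gt0.
  have u8 : 8 <= ln x by rewrite -ler_expR lnK// posrE.
  have u0 : 0 < ln x by lra.
  split=> //; apply: le_trans (bound _ _ _ u8) _; first by rewrite p0.
  rewrite ler_pM2r ?invr_gt0//; lra.
have lp : 0 <= ln p by rewrite ln_ge0// ltW.
(* Ensures both ln (x / p) >= 8 and ln (x / p) >= (ln x) / 2; the latter accounts for the factor 2
   in the bound. *)
exists (16 + 2 * ln p) => x xU.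
have x0 : 0 < x by apply: lt_le_trans xU; exact: expR_gt0.
have uU : 16 + 2 * ln p <= ln x by rewrite -ler_expR lnK// posrE.
have u0 : 0 < ln x by lra.
have lE : ln (x / p) = ln x - ln p by rewrite ln_div.
split=> //; rewrite infF_scale//.
have -> : e * ln x - (gainsup 1 + e * ln p) = e * ln (x / p) - gainsup 1.
  by rewrite lE; ring.
apply: le_trans (bound _ _ _ _) _; [by rewrite ltr01 lexx | by rewrite lE; lra |].
have -> : 2 * K / ln x = K / (ln x / 2) by field; rewrite gt_eqF.
by rewrite ler_pM2l// lef_pV2 ?posrE ?lE//; lra.
Qed.

Lemma deficit_incr (R : realType) (p q : R) : 0 < p -> p < q -> deficit p < deficit q.
Proof.
move=> p0 pq; rewrite /deficit; have e0 := e_gt0 R.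
have [q1|q1] := leP q 1.
  have -> : p <= 1 by lra.
  have := gainsup_incr p0 (ltW pq) q1; lra.
have [p1|p1] := leP p 1.
  have := gainsup_incr p0 p1 (lexx 1); have : 0 < ln q by rewrite ln_gt0.
  nra.
by rewrite ltrD2l ltr_pM2l// ltr_ln// posrE; lra.
Qed.

Theorem theorem4 (R : realType) :
  exists A : R -> R,
    [/\ (* (a) *)
        (forall p : R, 0 < p ->
           infF p = (fun x : R => expR 1 * ln x - A p)
                    +O_ +oo (fun x : R => (ln x)^-1)) /\
        (forall p q : R, 0 < p -> p < q -> A p < A q),
        (* (b) *)
        forall p : R, 1 < p ->
          (forall x : R, 0 < x -> infF p x = infF 1 (x / p)) /\
          A p = A 1 + expR 1 * ln p
      & (* (c) *)
        (forall p : R, 0 < p -> p < 1 ->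
           exists2 m : R,
             is_maximum [set A (p / v) - v + expR 1 * ln v | v in
                           [set v : R | 1 <= v <= expR 1]] m
             & A p = m + p) /\
        A = (fun p : R => p / (1 - (expR 1)^-1)) +o_ (0^'+) (fun p : R => p)].
Proof.
exists (@deficit R); split.
- split; last exact: deficit_incr.
  move=> p p0; apply/eqaddOP; have [U hU] := infF_asymptotics p0.
  apply: filterS (nbhs_pinfty_ge (num_real (2 * (1 + e ^+ 2 + 3 * e)))) => k hk.
  near=> x; have [|u0] := hU x.
    by near: x; exact: nbhs_pinfty_ge.
  move=> /le_trans; apply; rewrite gtr0_norm ?invr_gt0// ler_pM2r ?invr_gt0//.
- move=> p p1; split; first by move=> x x0; exact: infF_scale.
  by rewrite /deficit lexx leNgt p1.
split.
  move=> p p0 p1; have p01 : 0 < p < 1 by rewrite p0.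
  have [v v1e pE] := gainsup_functional p01.
  have deficitE w : 1 <= w -> deficit (p / w) = gainsup (p / w).
    by move=> w1; rewrite /deficit ler_pdivrMr; [rewrite mul1r; case: leP => //; lra | lra].
  exists (deficit (p / v) - v + e * ln v); last first.
    case/andP: v1e => v1 _.
    by rewrite deficitE// {1}/deficit (ltW p1) pE /phi; ring.
  split; first by exists v.
  move=> _ [w /andP[w1 we] <-]; case/andP: v1e => v1 _; rewrite !deficitE//.
  have := @gainsup_step _ p w; rewrite pE /phi p0 (ltW p1); lra.
apply/eqaddoP => eps eps0; have [d d0 hd] := gainsup_le_slope eps0.
near=> p; have p0 : 0 < p by near: p; exact: nbhs_right_gt.
have pd : p < d by near: p; exact: nbhs_right_lt.
have [|p1 hp] := hd p; first by rewrite p0.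
have := @gainsup_ge_slope _ p; rewrite p0 (ltW p1) => /(_ isT) hp'.
rewrite (gtr0_norm p0) [X in `|X|](_ : _ = gainsup p - gain_slope * p).
  rewrite ger0_norm; lra.
by rewrite -[RHS]/(_ - _) mulrC; congr (_ - _); rewrite /deficit (ltW p1).
Unshelve. all: by end_near. Qed.
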